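(* Fix the structure vector $\boldsymbol{\ell}=(\ell_1,\dots,\ell_{\mathcal K})$ and $A>0$. There exist constants $C^{(5)},C^{(6)}$, depending only on $\boldsymbol\ell$ and $A$ (in particular not on $\eta$ and $p$), such that the following holds. Let $\mathbf{x}\in\mathbb{C}^{R}$ be a data point with $|z_j|=1$ for $j=1,\dots,\mathcal K$ and $|a_{\ell,j}|\le A$ for all $\ell,j$, and let $p\ge 1$ be an integer such that $\eta_p>0$ and $a_{\ell_j-1,j}\ne 0$ for $j=1,\dots,\mathcal K$. Then the Jacobian matrix $\mathcal{J}^{(p)}(\mathbf{x})$ is invertible. Furthermore, for every $j=1,\dots,\mathcal K$, $$\kappa^{(p)}_{L_j+\ell}(\mathbf{x})\le C^{(5)}\cdot\left(\frac{1}{\eta_p^{(j)}}\right)^{R-\ell}\cdot\left(1+\frac{|a_{\ell-1,j}|}{|a_{\ell_j-1,j}|\,p^{\ell_j-\ell}}\right)\cdot\frac{1}{p^{\ell+1-\max_i\ell_i}},\qquad \ell=0,\dots,\ell_j-1,$$ $$\kappa^{(p)}_{L_j+\ell_j}(\mathbf{x})\le C^{(6)}\cdot\left(\frac{1}{\eta_p^{(j)}}\right)^{R-\ell_j}\cdot\frac{1}{|a_{\ell_j-1,j}|}\cdot\frac{1}{p^{\ell_j+1-\max_i\ell_i}}.$$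
   Context: Let $\mathcal K\ge 1$ and let $\boldsymbol{\ell}=(\ell_1,\dots,\ell_{\mathcal K})$ be a vector of positive integers (the problem structure vector). Put $R=\sum_{i=1}^{\mathcal K}\ell_i+\mathcal K$ and $L_j=1+\sum_{m=1}^{j-1}(\ell_m+1)$. A data point is a vector $\mathbf{x}=(a_{0,1},\dots,a_{\ell_1-1,1},z_1,\dots,a_{0,\mathcal K},\dots,a_{\ell_{\mathcal K}-1,\mathcal K},z_{\mathcal K})^T\in\mathbb{C}^R$, so that $a_{\ell,j}$ is the coordinate number $L_j+\ell$ and $z_j$ is the coordinate number $L_j+\ell_j$. Put $a_{-1,j}:=0$. For a positive integer $p$ (the decimation parameter), the decimated forward map $\mathcal{P}^{(p)}:\mathbb{C}^R\to\mathbb{C}^R$ is $\mathcal{P}^{(p)}(\mathbf{x})=(n_0,\dots,n_{R-1})$, where $$n_k=\sum_{j=1}^{\mathcal K}z_j^{pk}\sum_{\ell=0}^{\ell_j-1}(a_{\ell,j}p^\ell)k^\ell,\qquad k=0,\dots,R-1$$ (with $0^0=1$). $\mathcal{J}^{(p)}(\mathbf{x})$ is its $R\times R$ Jacobian matrix. At points where it is invertible, the decimated condition numbers are, for $\alpha=1,\dots,R$, $$\kappa^{(p)}_\alpha(\mathbf{x})=\sum_{i=1}^R\left|\left(\mathcal{J}^{(p)}(\mathbf{x})^{-1}\right)_{\alpha,i}\right|\,|n_{i-1}|.$$ For $|z_j|=1$, $\eta^{(j)}=\min_{r\ne j}|\arg z_r-\arg z_j|$ and $\eta=\min_j\eta^{(j)}$;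 similarly $\eta_p^{(j)}=\min_{r\neq j}|\arg z_r^p-\arg z_j^p|$ and $\eta_p=\min_j\eta_p^{(j)}$. Angles are measured modulo $2\pi$ so that these quantities are at most $\pi$ (an empty minimum is read as $\pi$). *)

(* Defs.v *)
From HB Require Import structures.
From mathcomp Require Import all_boot all_order all_algebra.
From mathcomp Require Import all_classical all_reals all_analysis.
From mathcomp Require Import complex.
Set Implicit Arguments.
Unset Strict Implicit.
Unset Printing Implicit Defensive.
Import Order.TTheory GRing.Theory Num.Theory.
Import numFieldNormedType.Exports.
Local Open Scope ring_scope.
Local Open Scope classical_set_scope.

(* The dimension R of the data points. *)
Definition nvars (K : nat) (ell : 'I_K -> nat) : nat := (\sum_(i < K) ell i + K)%N.

(* [offset ell j] is L_j - 1: indices below start from 0. *)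
Definition offset (K : nat) (ell : 'I_K -> nat) (j : 'I_K) : nat :=
  (\sum_(m < K | m < j) (ell m).+1)%N.

Lemma offset_lt (K : nat) (ell : 'I_K -> nat) (j : 'I_K) (m : 'I_(ell j).+1) :
  (offset ell j + m < nvars ell)%N.
Proof.
have -> : nvars ell = (\sum_(i < K) (ell i).+1)%N.
  rewrite /nvars; under [RHS]eq_bigr do rewrite -addn1.
  by rewrite big_split /= sum1_card card_ord.
rewrite (bigID (fun i : 'I_K => (i < j)%N)) /= -/(offset ell j) ltn_add2l.
by rewrite (bigD1 j) ?ltnn //=; exact: leq_trans (ltn_ord m) (leq_addr _ _).
Qed.

(* Coordinate number L_j + m, where 0 <= m <= l_j. *)
Definition cidx (K : nat) (ell : 'I_K -> nat) (j : 'I_K) (m : 'I_(ell j).+1) :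
  'I_(nvars ell) := Ordinal (offset_lt m).

Section ForwardMap.
Context (C : numFieldType) (K : nat) (ell : 'I_K -> nat).
Implicit Types (x : 'rV[C]_(nvars ell)) (j : 'I_K).

(* Only meaningful for l < ell j, because of [inord];
   at l = ell j it is the node z_j. *)
Definition acoord x j (l : nat) : C := x ord0 (cidx (inord l : 'I_(ell j).+1)).

Definition zcoord x j : C := x ord0 (cidx (ord_max : 'I_(ell j).+1)).

(* a_{l-1,j}, with the convention a_{-1,j} = 0. *)
Definition acoord_pred x j (l : nat) : C :=
  if l is l'.+1 then acoord x j l' else 0.

Definition fwd (p : nat) x : 'rV[C]_(nvars ell) :=
  \row_(k < nvars ell) \sum_(j < K) zcoord x j ^+ (p * k) *
    \sum_(l < ell j) (acoord x j l * p%:R ^+ l) * k%:R ^+ l.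

(* The library's ['J f x] acts on row vectors, i.e. its (i, k) entry is
   d f_k / d x_i; the transpose restores the usual convention. *)
Definition jac (p : nat) x : 'M[C]_(nvars ell) := ('J (fwd p) x)^T.

End ForwardMap.

Section Angles.
Context (R : realType).

(* Modulus as an element of [R] (whereas [`|z|] lives in [R[i]]). *)
Definition cmod (z : R[i]) : R := ComplexField.Normc.normc z.

(* Principal argument, in ]-pi, pi]; unspecified at z = 0. *)
Definition carg (z : R[i]) : R :=
  xget 0 [set t | - pi < t <= pi /\
                  z = Complex (cmod z * cos t) (cmod z * sin t)].

(* |arg z - arg w| modulo 2 pi, in [0, pi]. *)
Definition angdist (z w : R[i]) : R :=
  let d := `|carg z - carg w| in Num.min d (2 * pi - d).

Context (K : nat) (ell : 'I_K -> nat).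
Implicit Types (x : 'rV[R[i]]_(nvars ell)) (j : 'I_K).

(* As [angdist] is at most pi, the default value pi only matters for an empty
   minimum. *)
Definition eta_j (p : nat) x j : R :=
  \big[Num.min/pi]_(r < K | r != j) angdist (zcoord x r ^+ p) (zcoord x j ^+ p).

Definition eta_min (p : nat) x : R := \big[Num.min/pi]_(j < K) eta_j p x j.

Definition kappa (p : nat) x (alpha : 'I_(nvars ell)) : R :=
  \sum_(i < nvars ell) cmod (invmx (jac p x) alpha i) * cmod (fwd p x ord0 i).

End Angles.

(* Main.v *)
Require Import Defs.
From HB Require Import structures.
From mathcomp Require Import all_boot all_order all_algebra.
From mathcomp Require Import all_classical all_reals all_analysis.
From mathcomp Require Import complex ring lra zify.
Set Implicit Arguments.
Unset Strict Implicit.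
Unset Printing Implicit Defensive.
Import Order.TTheory GRing.Theory Num.Theory.
Import numFieldNormedType.Exports.
Local Open Scope ring_scope.

(** Put [w_i = z_i ^ p].  Column [(i, n)] of the Jacobian, for [n < l_i], is
    [p ^ n * k ^ n * w_i ^ k] (row [k]), and its column for the node [z_i] is
    [z_i ^ -1] times a combination of [p ^ n * k ^ n * w_i ^ k], [1 <= n <= l_i],
    with coefficients [a_{n-1,i}].  So inverting the Jacobian amounts to
    inverting the confluent Vandermonde matrix with entries [k ^ n * w_i ^ k],
    [n <= l_i], and [p] and the amplitudes enter only through explicit factors.

    A row of the inverse of that matrix is the coefficient vector of a
    polynomial [P] of degree at most [R - 1].  With [theta = X d/dX], the sum
    [\sum_k P_k k ^ n w ^ k] is [(theta ^ n P)(w)]; it is called an Euler moment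
    here.  The row of index [(j, m)] is the polynomial [P_{j,m}] all of whose
    moments of order at most [l_i] at the [w_i] vanish, except that of order [m]
    at [w_j], which is [1].  The whole matter is to bound the sum of the moduli
    of its coefficients by [B * e ^ (R - 1 - m)], where [e >= 1] bounds all the
    inverse distances [1 / |w_j - w_i|] and [B] depends only on the structure
    vector.

    The polynomial [Q_m = (X - w_j) ^ m * \prod_(i != j) ((X - w_i) / (w_j - w_i))
    ^ (l_i + 1)] has the right zeros at the other nodes, its moments of order
    less than [m] at [w_j] vanish and that of order [m] is [m! w_j ^ m].  As
    [theta] is a derivation, moments obey the Leibniz rule; each factor of the
    product has moments at [w_j] of order [n] at most [e ^ n], hence the moments
    of [Q_m] of order [n >= m] are [O (e ^ (n - m))] ([emom_seed_le]), while its
    coefficients are [O (e ^ (R - 1 - l_j))] ([l1norm_seed]).  The moments of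
    order between [m + 1] and [l_j] are then cleared by subtracting multiples of
    the [P_{j,n}] with [n > m], in a downward induction on [m]; the bounds fit
    together exactly: [e ^ (n - m) * e ^ (R - 1 - n) = e ^ (R - 1 - m)]
    ([dual_poly_exists]).

    For nodes on the unit circle a chord is at least a quarter of its angle
    ([angdist_le_chord]), so that [e = 4 / eta_j] is suitable; it is at least
    [1] because [eta_j <= pi <= 4].  The rows of the inverse Jacobian are the
    coefficients of [p ^ -l P_{j,l} - a_{l-1,j} / (a_{l_j-1,j} p ^ l_j) P_{j,l_j}]
    and [z_j / (a_{l_j-1,j} p ^ l_j) P_{j,l_j}] ([coef_poly_dual],
    [node_poly_dual]).  As the measurements are [O (p ^ (max l_i - 1))]
    ([cmod_fwd_le]), multiplying the bounds gives the theorem. *)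

(** * Euler moments of polynomials *)

Section EulerMoments.
Context (C : comNzRingType).
Implicit Types (P Q : {poly C}) (w : C).

Definition theta P := 'X * P^`().

Lemma thetaM P Q : theta (P * Q) = theta P * Q + P * theta Q.
Proof. by rewrite /theta derivM mulrDr !mulrA [P * 'X]mulrC. Qed.

Lemma coef_iter_theta n P k : (iter n theta P)`_k = P`_k * k%:R ^+ n.
Proof.
elim: n => [|n IHn] /=; first by rewrite mulr1.
rewrite coefXM; case: k IHn => [|k] IHn; first by rewrite expr0n !mulr0.
by rewrite coef_deriv IHn /= -[LHS]mulr_natr exprSr mulrA.
Qed.

Lemma iter_thetaM n P Q : iter n theta (P * Q) =
  \sum_(i < n.+1) (iter i theta P * iter (n - i) theta Q) *+ 'C(n, i).
Proof.
elim: n => [|n IHn]; first by rewrite big_ord1.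
have theta_sum m (F : 'I_m -> {poly C}) :
    theta (\sum_(i < m) F i) = \sum_(i < m) theta (F i).
  by rewrite /theta raddf_sum mulr_sumr.
have thetaMn F m : theta (F *+ m) = theta F *+ m.
  by rewrite /theta derivMn mulrnAr.
rewrite iterS IHn theta_sum.
under eq_bigr do rewrite thetaMn thetaM mulrnDl -!iterS.
rewrite big_split /= big_ord_recr big_ord_recl [RHS]big_ord_recl big_ord_recr /=.
rewrite !subnn !subn0 !bin0 !binn !mulr1n.
rewrite [X in _ = _ + (X + _)](_ : _ =
   \sum_(i < n) (iter i.+1 theta P * iter (n - i) theta Q) *+ 'C(n, i.+1)
 + \sum_(i < n) (iter i.+1 theta P * iter (n - i) theta Q) *+ 'C(n, i)); last first.
  by rewrite -big_split /=; apply: eq_bigr => i _; rewrite binS mulrnDr subSS.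
set S := \sum_(i < n) _ *+ 'C(n, bump 0 i).
have -> : S = \sum_(i < n) (iter i.+1 theta P * iter (n - i) theta Q) *+ 'C(n, i.+1).
  by apply: eq_bigr => i _; rewrite /bump /= add1n add0n -!iterS -subSn // subSS.
by ring.
Qed.

(** Unfolded, this is [\sum_k P_k k ^ n w ^ k] (see [emom_widen]): a linear
    form in the coefficients of [P], whose coordinates form one column of the
    confluent Vandermonde matrix. *)
Definition emom n w P := (iter n theta P).[w].

Lemma emom_widen N n w P : (size P <= N)%N ->
  emom n w P = \sum_(k < N) P`_k * k%:R ^+ n * w ^+ k.
Proof.
move=> sP; rewrite /emom (@horner_coef_wide _ N).
  by apply: eq_bigr => k _; rewrite coef_iter_theta.
apply/leq_sizeP => k Nk; rewrite coef_iter_theta (leq_sizeP _ _ sP) ?mul0r //.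
Qed.

Lemma emom_is_linear n w : scalar (emom n w).
Proof.
move=> a P Q; set N := maxn (size P) (size Q).
have sP : (size P <= N)%N by rewrite leq_maxl.
have sQ : (size Q <= N)%N by rewrite leq_maxr.
have sPQ : (size (a *: P + Q)%R <= N)%N.
  apply: leq_trans (size_polyD _ _) _; rewrite geq_max sQ andbT.
  exact: leq_trans (size_scale_leq _ _) sP.
rewrite !(@emom_widen N) // mulr_sumr -big_split /=; apply: eq_bigr => k _.
by rewrite coefD coefZ !mulrDl !mulrA.
Qed.

HB.instance Definition _ n w :=
  GRing.isLinear.Build C {poly C} C *%R (emom n w) (emom_is_linear n w).

Lemma emomM n w P Q : emom n w (P * Q) =
  \sum_(i < n.+1) (emom i w P * emom (n - i) w Q) *+ 'C(n, i).
Proof.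
rewrite /emom iter_thetaM horner_sum; apply: eq_bigr => i _.
by rewrite hornerMn hornerM.
Qed.

(** Each application of [theta] lowers by one the order of vanishing at [w]
    and multiplies the leading Taylor coefficient by that order times [w]. *)
Lemma emom_XsubC_exp n w Q :
  emom n w (('X - w%:P) ^+ n * Q) = n`!%:R * w ^+ n * Q.[w].
Proof.
elim: n Q => [|n IHn] Q; first by rewrite /emom /= !expr0 !mul1r.
have -> : emom n.+1 w (('X - w%:P) ^+ n.+1 * Q) =
  emom n w (('X - w%:P) ^+ n * ('X * Q *+ n.+1 + ('X - w%:P) * theta Q)).
  rewrite /emom iterSr /theta derivM deriv_exp derivXsubC mul1r /=.
  congr ((iter _ _ _).[_]); rewrite exprS -mulr_natr; ring.
rewrite IHn hornerD hornerMn !hornerM hornerXsubC hornerX subrr mul0r addr0.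
rewrite factS natrM exprS -mulr_natr; ring.
Qed.
End EulerMoments.

(** * Growth of Euler moments and coefficient norms *)

Section EulerMomentBounds.
Context (C : numFieldType).
Implicit Types (P Q : {poly C}) (w v e : C).

Lemma emom_exp_lt n m w Q : (n < m)%N -> emom n w (('X - w%:P) ^+ m * Q) = 0.
Proof.
move=> nm; rewrite -(subnKC (ltnW nm)) exprD -mulrA emom_XsubC_exp hornerM.
by rewrite horner_exp hornerXsubC subrr expr0n subn_eq0 leqNgt nm mul0r mulr0.
Qed.

Lemma emom_dvd n m w P : (n < m)%N -> ('X - w%:P) ^+ m %| P -> emom n w P = 0.
Proof. by move=> nm /dvdpP[Q ->]; rewrite mulrC emom_exp_lt. Qed.

Lemma emom_XsubC n w v : emom n w ('X - v%:P) = w - v * 0 ^+ n.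
Proof.
rewrite (@emom_widen _ 2) ?size_XsubC // big_ord_recr big_ord1 /=.
by rewrite !coefB !coefX !coefC /= expr1n !expr1 expr0 sub0r subr0 !mulr1 mul1r mulNr addrC.
Qed.

(** This geometric form of the bound is the one stable under products: by the
    Leibniz and binomial formulas, the constants [M] just add up. *)
Definition emom_growth w e (M : nat) P :=
  forall n, `|emom n w P| <= M%:R ^+ n * e ^+ n.

Lemma emom_growth1 w e : emom_growth w e 0 1.
Proof.
move=> n; rewrite (@emom_widen _ 1) ?size_poly1 // big_ord1 coefC /= expr0 mulr1 mul1r.
by case: n => [|n]; rewrite ?expr0 ?normr1 ?mulr1 // !expr0n /= mul0r normr0.
Qed.

Lemma emom_growthM w e M N P Q : 0 <= e ->
  emom_growth w e M P -> emom_growth w e N Q -> emom_growth w e (M + N) (P * Q).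
Proof.
move=> e0 hP hQ n; rewrite emomM natrD [M%:R + _]addrC (exprDn N%:R) mulr_suml.
apply: (le_trans (ler_norm_sum _ _ _)); apply: ler_sum => i _.
rewrite normrMn normrM mulrnAl lerMn2r; apply/orP; right.
have -> : N%:R ^+ (n - i) * M%:R ^+ i * e ^+ n =
   (M%:R ^+ i * e ^+ i) * (N%:R ^+ (n - i) * e ^+ (n - i)).
  rewrite mulrACA -exprD subnKC; last by rewrite -ltnS.
  by rewrite [M%:R ^+ i * _]mulrC.
by apply: ler_pM; rewrite ?normr_ge0.
Qed.

Lemma emom_growthX w e M P n : 0 <= e ->
  emom_growth w e M P -> emom_growth w e (n * M) (P ^+ n).
Proof.
move=> e0 hP; elim: n => [|n IHn]; first exact: emom_growth1.
by rewrite exprS mulSn; apply: emom_growthM.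
Qed.

Lemma emom_growth_prod (I : Type) (r : seq I) (D : pred I) w e
    (M : I -> nat) (F : I -> {poly C}) : 0 <= e ->
  (forall i, D i -> emom_growth w e (M i) (F i)) ->
  emom_growth w e (\sum_(i <- r | D i) M i) (\prod_(i <- r | D i) F i).
Proof.
move=> e0 hF; apply: (big_rec2 (fun m P => emom_growth w e m P)) => [|i m P Di hP].
  exact: emom_growth1.
by apply: emom_growthM => //; apply: hF.
Qed.

Lemma emom_growth_XsubC w : `|w| = 1 -> emom_growth w 1 1 ('X - w%:P).
Proof.
move=> w1 n; rewrite emom_XsubC !expr1n mulr1.
by case: n => [|n]; rewrite ?mulr1 ?subrr ?normr0 // expr0n /= mulr0 subr0 w1.
Qed.

Lemma emom_growth_factor w v e : 1 <= e -> `|w| = 1 -> w != v ->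
  `|(w - v)^-1| <= e -> emom_growth w e 1 ((w - v)^-1 *: ('X - v%:P)).
Proof.
move=> e1 w1 wv hv n; rewrite linearZ /= emom_XsubC expr1n mul1r.
case: n => [|n]; first by rewrite !expr0 mulr1 mulVf ?subr_eq0 // normr1.
rewrite expr0n /= mulr0 subr0 normrM w1 mulr1 (le_trans hv) //.
by rewrite exprS ler_peMr ?exprn_ege1 // (le_trans ler01).
Qed.

(** In the Leibniz formula the first [m] moments of [(X - w) ^ m] vanish, so
    the other factor is differentiated at most [n - m] times and contributes at
    most [e ^ (n - m)]. *)
Lemma emom_growth_vanish w e M N m n Q : 1 <= e -> (m <= n)%N ->
  emom_growth w 1 M (('X - w%:P) ^+ m) -> emom_growth w e N Q ->
  `|emom n w (('X - w%:P) ^+ m * Q)| <= (M + N)%:R ^+ n * e ^+ (n - m).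
Proof.
move=> e1 mn hP hQ; have e0 : 0 <= e by apply: le_trans e1.
rewrite emomM natrD [M%:R + _]addrC (exprDn N%:R) mulr_suml.
apply: (le_trans (ler_norm_sum _ _ _)); apply: ler_sum => i _.
rewrite normrMn normrM mulrnAl lerMn2r; apply/orP; right.
have [im|mi] := ltnP i m.
  by rewrite -[_ ^+ m]mulr1 emom_exp_lt // normr0 mul0r; do !apply: mulr_ge0; apply: exprn_ge0.
rewrite (mulrC (N%:R ^+ _)) -mulrA; apply: ler_pM => //; first by have := hP i; rewrite expr1n mulr1.
apply: le_trans (hQ _) _; apply: ler_wpM2l; first exact: exprn_ge0.
by apply: ler_weXn2l => //; apply: leq_sub2l.
Qed.

Definition l1norm P := \sum_(k < size P) `|P`_k|.

Lemma l1norm_widen N P : (size P <= N)%N -> l1norm P = \sum_(k < N) `|P`_k|.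
Proof.
move=> sP; rewrite /l1norm (big_ord_widen _ (fun k => `|P`_k|) sP) big_mkcond /=.
by apply: eq_bigr => k _; case: ltnP => // /(nth_default _) ->; rewrite normr0.
Qed.

Lemma l1norm_ge0 P : 0 <= l1norm P.
Proof. exact: sumr_ge0. Qed.

Lemma l1norm0 : l1norm 0 = 0.
Proof. by rewrite /l1norm size_poly0 big_ord0. Qed.

Lemma l1normD P Q : l1norm (P + Q) <= l1norm P + l1norm Q.
Proof.
set N := maxn (size P) (size Q).
have sP : (size P <= N)%N by rewrite leq_maxl.
have sQ : (size Q <= N)%N by rewrite leq_maxr.
have sPQ : (size (P + Q)%R <= N)%N by apply: size_polyD.
rewrite !(@l1norm_widen N) // -big_split; apply: ler_sum => k _.
by rewrite coefD ler_normD.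
Qed.

Lemma l1normZ a P : l1norm (a *: P) = `|a| * l1norm P.
Proof.
rewrite (@l1norm_widen (size P)) ?size_scale_leq // mulr_sumr.
by apply: eq_bigr => k _; rewrite coefZ normrM.
Qed.

Lemma l1norm_sum (I : Type) (r : seq I) (D : pred I) (F : I -> {poly C}) :
  l1norm (\sum_(i <- r | D i) F i) <= \sum_(i <- r | D i) l1norm (F i).
Proof.
apply: (big_rec2 (fun P s => l1norm P <= s)) => [|i s P _ hP]; first by rewrite l1norm0.
by apply: le_trans (l1normD _ _) _; rewrite lerD2l.
Qed.

Lemma l1normXn n P : l1norm ('X^n * P) = l1norm P.
Proof.
rewrite (@l1norm_widen (n + size P)); last first.
  by apply: leq_trans (size_polyMleq _ _) _; rewrite size_polyXn.
rewrite big_split_ord /= big1 ?add0r => [|k _].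
  by apply: eq_bigr => k _; rewrite coefXnM /= ltnNge leq_addr /= addKn.
by rewrite coefXnM ltn_ord normr0.
Qed.

Lemma l1normM P Q : l1norm (P * Q) <= l1norm P * l1norm Q.
Proof.
rewrite -[P in P * Q]coefK poly_def mulr_suml mulr_suml.
apply: le_trans (l1norm_sum _ _ _) _; apply: ler_sum => k _.
by rewrite -scalerAl l1normZ l1normXn.
Qed.

Lemma l1norm1 : l1norm 1 = 1.
Proof. by rewrite (@l1norm_widen 1) ?size_poly1 // big_ord1 coefC /= normr1. Qed.

Lemma l1norm_expM P b n Q : 0 <= b -> l1norm P <= b ->
  l1norm (P ^+ n * Q) <= b ^+ n * l1norm Q.
Proof.
move=> b0 hP; elim: n => [|n IHn]; first by rewrite !mul1r.
rewrite !exprS -!mulrA; apply: le_trans (l1normM _ _) _.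
by apply: ler_pM => //; apply: l1norm_ge0.
Qed.

Lemma l1norm_XsubC v : `|v| = 1 -> l1norm ('X - v%:P) = 2.
Proof.
move=> v1; rewrite /l1norm size_XsubC big_ord_recr big_ord1 /= !coefB !coefX !coefC /=.
by rewrite sub0r subr0 normrN v1 normr1.
Qed.

End EulerMomentBounds.

(** * Dual polynomials of the confluent Vandermonde matrix *)

Lemma nvarsE K (ell : 'I_K -> nat) : nvars ell = (\sum_(i < K) (ell i).+1)%N.
Proof.
rewrite /nvars; under [RHS]eq_bigr do rewrite -addn1.
by rewrite big_split /= sum1_card card_ord.
Qed.

Section DualPolynomials.
Context (C : numFieldType) (K : nat) (ell : 'I_K -> nat).
Local Notation N := (nvars ell).
Implicit Types (w : 'I_K -> C) (e : C) (j : 'I_K).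

(** The number of moment conditions at the nodes other than the [j]-th. *)
Definition cofactor_degree j := (\sum_(i < K | i != j) (ell i).+1)%N.

Lemma cofactor_degreeE j : (cofactor_degree j + (ell j).+1 = N)%N.
Proof. by rewrite nvarsE (bigD1 j) //= addnC. Qed.

(** The leading term of the dual polynomial [P_{j,m}]: it satisfies all the
    moment conditions but those of order [m + 1] to [ell j] at [w j], up to the
    factor [m! w_j ^ m]. *)
Definition seed w j m : {poly C} := ('X - (w j)%:P) ^+ m *
  \prod_(i < K | i != j) ((w j - w i)^-1 *: ('X - (w i)%:P)) ^+ (ell i).+1.

Definition separated w e j := [/\ forall i, `|w i| = 1, 1 <= e &
  forall i, i != j -> w j != w i /\ `|(w j - w i)^-1| <= e].

Lemma size_seed w j m : (m <= ell j)%N -> (size (seed w j m) <= N)%N.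
Proof.
move=> mj; apply: leq_trans (size_polyMleq _ _) _.
rewrite size_exp_XsubC /= -(cofactor_degreeE j).
suff h : (size (\prod_(i < K | i != j)
    ((w j - w i)^-1 *: ('X - (w i)%:P)) ^+ (ell i).+1)%R <= (cofactor_degree j).+1)%N.
  by apply: leq_trans (leq_add (leqnn m) h) _; lia.
rewrite /cofactor_degree; elim/big_rec2: _ => [|i n P _ hP].
  by rewrite size_poly1.
apply: leq_trans (size_polyMleq _ _) _.
have h : (size (((w j - w i)^-1 *: ('X - (w i)%:P)) ^+ (ell i).+1)%R <= (ell i).+2)%N.
  apply: leq_trans (size_poly_exp_leq _ _) _; rewrite ltnS.
  have : (size ((w j - w i)^-1 *: ('X - (w i)%:P))%R <= 2)%N.
    by rewrite (leq_trans (size_scale_leq _ _)) ?size_XsubC.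
  by case: (size _) => [|[|[|]]] //= _; rewrite ?mul0n ?mul1n.
lia.
Qed.

Lemma emom_seed_other w j m i n : i != j -> (n <= ell i)%N ->
  emom n (w i) (seed w j m) = 0.
Proof.
move=> ij ni; apply: (@emom_dvd _ n (ell i).+1) => //.
rewrite /seed (bigD1 i) //= exprZn; apply: dvdp_mull; apply: dvdp_mulr.
by rewrite -mul_polyC dvdp_mulIr.
Qed.

Lemma emom_seed_lt w j m n : (n < m)%N -> emom n (w j) (seed w j m) = 0.
Proof. by move=> nm; rewrite emom_exp_lt. Qed.

Lemma emom_seed_diag w e j m : separated w e j ->
  emom m (w j) (seed w j m) = m`!%:R * w j ^+ m.
Proof.
move=> [_ _ sep]; rewrite emom_XsubC_exp horner_prod big1 ?mulr1 // => i /sep[wij _].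
by rewrite horner_exp hornerZ hornerXsubC mulVf ?subr_eq0 // expr1n.
Qed.

(** The product over the other nodes has [cofactor_degree j] factors, each with
    moments of order [n] at most [e ^ n], and the zero of order [m] at [w j]
    absorbs [m] of the [n] derivations. *)
Lemma emom_seed_le w e j m n : separated w e j -> (m <= ell j)%N -> (m <= n)%N ->
  (n <= N)%N -> `|emom n (w j) (seed w j m)| <= (N ^ N)%:R * e ^+ (n - m).
Proof.
move=> [w1 e1 sep] mj mn nN; have e0 : 0 <= e by apply: le_trans e1.
have hP : emom_growth (w j) 1 m (('X - (w j)%:P) ^+ m).
  by have := emom_growthX m ler01 (emom_growth_XsubC (w1 j)); rewrite muln1.
have hQ : emom_growth (w j) e (cofactor_degree j)
    (\prod_(i < K | i != j) ((w j - w i)^-1 *: ('X - (w i)%:P)) ^+ (ell i).+1).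
  apply: emom_growth_prod => // i /sep[wij hij].
  by have := emom_growthX (ell i).+1 e0 (emom_growth_factor e1 (w1 j) wij hij); rewrite muln1.
apply: le_trans (emom_growth_vanish e1 mn hP hQ) _.
apply: ler_wpM2r; first exact: exprn_ge0.
rewrite -natrX ler_nat; have := cofactor_degreeE j => hN.
have h : (m + cofactor_degree j <= N)%N by rewrite -hN addnC leq_add2l ltnW.
apply: leq_trans (_ : (N ^ n <= _)%N); first by case: (n) => // k; rewrite leq_exp2r.
by rewrite leq_pexp2l // -hN addnS.
Qed.

Lemma l1norm_seed w e j m : separated w e j -> (m <= ell j)%N ->
  l1norm (seed w j m) <= (2 ^ N)%:R * e ^+ cofactor_degree j.
Proof.
move=> [w1 e1 sep] mj; have e0 : 0 <= e by apply: le_trans e1.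
apply: (@le_trans _ _ (2 ^+ m * (2 * e) ^+ cofactor_degree j)).
  apply: le_trans (l1norm_expM _ _ (ler0n _ 2) _) _; first by rewrite l1norm_XsubC.
  apply: ler_wpM2l; first exact: exprn_ge0.
  rewrite /cofactor_degree; apply: (big_rec2 (fun P (n : nat) => l1norm P <= (2 * e) ^+ n)) => [|i P n ij hP].
    by rewrite l1norm1.
  have e20 : 0 <= 2 * e by rewrite mulr_ge0.
  apply: le_trans (l1norm_expM _ _ e20 _) _.
    rewrite l1normZ l1norm_XsubC // mulrC; have [_ ?] := sep _ ij.
    exact: ler_wpM2l.
  by rewrite exprD; apply: ler_wpM2l => //; apply: exprn_ge0.
rewrite exprMn mulrA -exprD natrX; apply: ler_wpM2r; first exact: exprn_ge0.
by apply: ler_weXn2l; rewrite ?ler1n // -(cofactor_degreeE j) addnC leq_add2l ltnW.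
Qed.

Definition dual_poly w j m (P : {poly C}) :=
  (size P <= N)%N /\ forall i n, (n <= ell i)%N ->
    emom n (w i) P = ((i == j) && (n == m))%:R.

(** Downward induction on [m], [d] bounding [ell j - m]: the moments of the seed
    of order [n] between [m + 1] and [ell j] are cleared by means of the dual
    polynomials of order [n] already built.  The number [B] comes before the
    nodes, so it depends on the multiplicities only. *)
Lemma dual_poly_exists d : exists B : nat, forall w e j m,
  separated w e j -> (m <= ell j)%N -> (ell j - m < d)%N ->
  exists2 P, dual_poly w j m P & l1norm P <= B%:R * e ^+ (N.-1 - m).
Proof.
elim: d => [|d [B IHd]]; first by exists 0%N => w e j m _ _; rewrite ltn0.
(* [2 ^ N] is for the seed and [N ^ N * B] for each of the at most [N] corrections. *)
exists (2 ^ N + N * (N ^ N * B))%N => w e j m sep mj mjd.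
have [w1 e1 _] := sep; have e0 : 0 <= e by apply: le_trans e1.
have /choice[P hP] : forall n : 'I_(ell j).+1, exists P : {poly C}, (m < n)%N ->
    dual_poly w j n P /\ l1norm P <= B%:R * e ^+ (N.-1 - n).
  move=> n; have [mn|nm] := ltnP m n; last by exists 0.
  have nj : (n <= ell j)%N by rewrite -ltnS.
  have [|P ? ?] := IHd w e j n sep nj; last by exists P.
  by move: mjd mn nj; clear; lia.
set c : C := m`!%:R * w j ^+ m.
have wj0 : w j != 0 by rewrite -normr_eq0 w1 oner_eq0.
have c0 : c != 0.
  by rewrite mulf_neq0 ?expf_neq0 // pnatr_eq0 -lt0n fact_gt0.
have c1 : `|c^-1| <= 1.
  rewrite normfV normrM normrX w1 expr1n mulr1 normr_nat.
  by rewrite invf_le1 ?ltr0n ?ler1n fact_gt0.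
have NE := cofactor_degreeE j.
set corr := \sum_(n < (ell j).+1 | (m < n)%N) emom n (w j) (seed w j m) *: P n.
exists (c^-1 *: (seed w j m - corr)).
  split.
    apply: leq_trans (size_scale_leq _ _) _; apply: leq_trans (size_polyD _ _) _.
    rewrite geq_max size_seed //= size_polyN.
    apply: leq_trans (size_sum _ _ _) _; apply/bigmax_leqP => n /hP[[sP _] _].
    exact: leq_trans (size_scale_leq _ _) sP.
  move=> i n ni; rewrite linearZ linearB linear_sum /=.
  under eq_bigr => k mk.
    rewrite linearZ /=; have [[_ ->] // _] := hP _ mk; over.
  have [ij|ij] /= := eqVneq i j; last first.
    by rewrite emom_seed_other // sub0r big1 ?oppr0 ?mulr0 // => k _; rewrite mulr0.
  subst i; have [nm|nm] := eqVneq n m.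
    rewrite nm (emom_seed_diag _ sep) big1 ?subr0 ?mulVf // => k mk.
    by rewrite ltn_eqF ?mulr0.
  have [ltnm|] := ltnP n m.
    rewrite emom_seed_lt // sub0r big1 ?oppr0 ?mulr0 // => k mk.
    by rewrite ltn_eqF ?mulr0 // (ltn_trans ltnm).
  rewrite leq_eqVlt eq_sym (negPf nm) /= => mn.
  have nk : (n < (ell j).+1)%N by [].
  rewrite (bigD1 (Ordinal nk)) //= eqxx mulr1 big1 ?addr0 ?subrr ?mulr0 // => k.
  by move=> /andP[_ /negPf kn]; rewrite -val_eqE /= in kn; rewrite eq_sym kn mulr0.
rewrite l1normZ; apply: le_trans (ler_piMl (l1norm_ge0 _) c1) _.
rewrite -scaleN1r; apply: le_trans (l1normD _ _) _.
rewrite l1normZ normrN1 mul1r natrD mulrDl; apply: lerD.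
  apply: le_trans (l1norm_seed sep mj) _; apply: ler_wpM2l; first exact: ler0n.
  by apply: ler_weXn2l => //; lia.
apply: le_trans (l1norm_sum _ _ _) _.
have term (n : 'I_(ell j).+1) : (m < n)%N ->
    l1norm (emom n (w j) (seed w j m) *: P n) <= (N ^ N * B)%:R * e ^+ (N.-1 - m).
  move=> mn; rewrite l1normZ; have [_ hPn] := hP _ mn.
  have nj : (n <= ell j)%N by rewrite -ltnS.
  (* The loss [e ^ (n - m)] on the moment is what the bound on [P n] gains. *)
  have -> : (N.-1 - m = (n - m) + (N.-1 - n))%N by lia.
  rewrite natrM exprD mulrACA; apply: ler_pM => //; first exact: l1norm_ge0.
  by apply: emom_seed_le sep _ _ _ => //; lia.
apply: le_trans (ler_sum _ term) _.
rewrite big_mkcond /=.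
apply: (@le_trans _ _ (\sum_(n < (ell j).+1) (N ^ N * B)%:R * e ^+ (N.-1 - m))).
  by apply: ler_sum => n _; case: ifP => // _; rewrite mulr_ge0 ?exprn_ge0.
rewrite sumr_const card_ord -[leLHS]mulr_natl [in leRHS]natrM -[leRHS]mulrA.
apply: ler_wpM2r; first by rewrite mulr_ge0 ?exprn_ge0.
by rewrite ler_nat -NE leq_addl.
Qed.

End DualPolynomials.

(** * Coordinates of data points and entries of the Jacobian *)

Section Coordinates.
Context (K : nat) (ell : 'I_K -> nat).

Lemma offset_mono (i j : 'I_K) : (i < j)%N -> (offset ell i + (ell i).+1 <= offset ell j)%N.
Proof.
move=> ij; rewrite /offset [X in (_ <= X)%N](bigD1 i) //= addnC leq_add2l.
rewrite [X in (_ <= X)%N](bigID (fun m : 'I_K => (m < i)%N)) /=.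
apply: leq_trans (leq_addr _ _); rewrite leq_eqVlt; apply/orP; left; apply/eqP.
apply: eq_bigl => m; case: (ltnP m i) => mi; rewrite ?andbF // andbT.
by rewrite (ltn_trans mi ij) /= neq_ltn mi.
Qed.

Lemma cidx_inj (i j : 'I_K) (m : 'I_(ell i).+1) (n : 'I_(ell j).+1) :
  cidx m = cidx n -> i = j /\ m = n :> nat.
Proof.
move=> /(congr1 val) /= h; suff ij : i = j by subst j; split=> //; apply: addnI h.
apply/val_inj; case: (ltngtP i j) => // /offset_mono.
  by have := ltn_ord m; move: h; lia.
by have := ltn_ord n; move: h; lia.
Qed.

(** The index [cidx] is injective on pairs [(j, m)], and there are
    [\sum_j (ell j).+1 = nvars ell] of them. *)
Lemma cidx_surj (alpha : 'I_(nvars ell)) : exists (j : 'I_K) (m : 'I_(ell j).+1), alpha = cidx m.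
Proof.
pose f (u : {i : 'I_K & 'I_(ell i).+1}) := cidx (tagged u).
have finj : injective f.
  move=> [i m] [j n] /cidx_inj /= [ij mn]; subst j; congr existT; exact: val_inj.
have fsurj : codom f =i predT.
  apply/inj_card_onto => //; rewrite card_ord card_tagged sumnE big_map big_enum /=.
  by rewrite nvarsE; under eq_bigr do rewrite card_ord.
have /codomP[[i m] ->] : alpha \in codom f by rewrite fsurj.
by exists i, m.
Qed.

Lemma acoord_delta (C : numFieldType) (i j : 'I_K) (m : 'I_(ell i).+1) l : (l < ell j)%N ->
  acoord (delta_mx ord0 (cidx m) : 'rV[C]_(nvars ell)) j l = ((i == j) && (m == l :> nat))%:R.
Proof.
move=> lj; rewrite /acoord mxE eqxx /=; congr ((_ : bool)%:R).
apply/eqP/andP => [/cidx_inj[ij ml]|[/eqP ij /eqP ml]].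
  by rewrite -ml ij inordK ?eqxx // leqW // -ij.
by subst j; congr cidx; apply: val_inj; rewrite /= inordK // leqW.
Qed.

Lemma zcoord_delta (C : numFieldType) (i j : 'I_K) (m : 'I_(ell i).+1) :
  zcoord (delta_mx ord0 (cidx m) : 'rV[C]_(nvars ell)) j = ((i == j) && (m == ell j :> nat))%:R.
Proof.
rewrite /zcoord mxE eqxx /=; congr ((_ : bool)%:R).
apply/eqP/andP => [/cidx_inj[ij ml]|[/eqP ij /eqP ml]].
  by rewrite -ml ij !eqxx.
by subst j; congr cidx; apply: val_inj.
Qed.

End Coordinates.

Section Jacobian.
Context (C : numFieldType) (K : nat) (ell : 'I_K -> nat).
Implicit Types (x v : 'rV[C]_(nvars ell)) (p : nat).

Definition fwd_coord p (k : nat) x : C := \sum_(j < K) zcoord x j ^+ (p * k) *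
    \sum_(l < ell j) (acoord x j l * p%:R ^+ l) * k%:R ^+ l.

(** Each measurement as an expression in the ring of functions of the data
    point, the form to which the rules of differentiation apply. *)
Lemma fwd_coordE p (k : nat) : fwd_coord p k =
  \sum_(j < K) ((fun x => zcoord x j) ^+ (p * k)) *
    (\sum_(l < ell j) (p%:R ^+ l * k%:R ^+ l) *: (fun x => acoord x j l)).
Proof.
apply/funext => x; rewrite /fwd_coord fct_sumE; apply: eq_bigr => j _.
rewrite mulrfctE exprfctE; congr (_ * _); rewrite fct_sumE.
by apply: eq_bigr => l _; rewrite scalrfctE -mulrA mulrC.
Qed.

Lemma diff_coord n (M : 'rV[C]_n) i : 'd (fun y : 'rV[C]_n => y ord0 i) M = (fun y => y ord0 i) :> ('rV[C]_n -> C).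
Proof.
have @f : {linear 'rV[C]_n -> C}.
  by exists (fun y : 'rV[C]_n => y ord0 i); do 2![eexists]; do ?[constructor];
     rewrite ?mxE// => ? *; rewrite ?mxE//; move=> ?; rewrite !mxE.
by rewrite (_ : (fun y : 'rV[C]_n => y ord0 i) = f) // diff_lin //; apply: coord_continuous.
Qed.

Lemma is_derive_coord x v i : is_derive x v (fun y : 'rV[C]_(nvars ell) => y ord0 i) (v ord0 i).
Proof.
have df := differentiable_coord x ord0 i.
by apply: DeriveDef; [exact: diff_derivable|rewrite deriveE // diff_coord].
Qed.

Lemma differentiable_fwd_coord p k x : differentiable (fwd_coord p k) x.
Proof.
rewrite fwd_coordE; apply: differentiable_sum => j; apply: differentiableM.
  case: (p * k)%N => [|n]; last by apply/differentiableX/differentiable_coord.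
  by rewrite expr0; apply: differentiable_cst.
by apply: differentiable_sum => l; apply/differentiableZ/differentiable_coord.
Qed.

Lemma derive_fwd_coord p k x v : 'D_v (fwd_coord p k) x = \sum_(j < K)
   (zcoord x j ^+ (p * k) * (\sum_(l < ell j) (acoord v j l * p%:R ^+ l) * k%:R ^+ l)
  + (\sum_(l < ell j) (acoord x j l * p%:R ^+ l) * k%:R ^+ l) *
     ((p * k)%:R * zcoord x j ^+ (p * k).-1 * zcoord v j)).
Proof.
apply: derive_val; rewrite fwd_coordE.
apply: is_derive_eq.
  apply: is_derive_sum => j; apply: is_deriveM.
    by apply: is_deriveX; apply: is_derive_coord.
  by apply: is_derive_sum => l; apply: is_deriveZ; apply: is_derive_coord.
apply: eq_bigr => j _; rewrite exprfctE fct_sumE; congr (_ * _ + _ * _).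
  by apply: eq_bigr => l _; rewrite -mulrA [RHS]mulrC.
by apply: eq_bigr => l _; rewrite -mulrA [RHS]mulrC.
Qed.

Lemma fwd_sum p : fwd p = \sum_(k < nvars ell) (fun x => fwd_coord p k x *: delta_mx ord0 k).
Proof.
apply/funext => x; rewrite fct_sumE [LHS]row_sum_delta; apply: eq_bigr => k _.
by rewrite mxE.
Qed.

Lemma differentiable_fwd p x : differentiable (fwd p) x.
Proof.
rewrite fwd_sum; apply: differentiable_sum => k; apply: differentiableZl.
exact: differentiable_fwd_coord.
Qed.

Lemma jacE p x k a : jac p x k a = 'D_(delta_mx ord0 a) (fwd_coord p k) x.
Proof.
have dfwd := differentiable_fwd p x.
have -> : fwd_coord p k = (fun y : 'rV[C]_(nvars ell) => y ord0 k) \o fwd p.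
  by apply/funext => y; rewrite /comp /fwd mxE.
rewrite deriveE; last by apply: differentiable_comp => //; apply: differentiable_coord.
rewrite diff_comp //; last exact: differentiable_coord.
rewrite [RHS]/= diff_coord -deriveE // deriveEjacobian // -rowE !mxE.
by [].
Qed.

Lemma jac_coef p x k (i : 'I_K) (n : 'I_(ell i).+1) : (n < ell i)%N ->
  jac p x k (cidx n) = p%:R ^+ n * (k%:R ^+ n * (zcoord x i ^+ p) ^+ k).
Proof.
move=> ni; rewrite jacE derive_fwd_coord (bigD1 i) //= [X in _ + X]big1 ?addr0; last first.
  move=> j /negPf ji; rewrite zcoord_delta eq_sym ji /= !mulr0 addr0.
  by rewrite big1 ?mulr0 // => l _; rewrite acoord_delta // eq_sym ji !mul0r.
rewrite zcoord_delta eqxx /= ltn_eqF // !mulr0 addr0 (bigD1 (Ordinal ni)) //=.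
rewrite acoord_delta // !eqxx mul1r big1 ?addr0.
  by rewrite exprM mulrC mulrA.
by move=> l; rewrite -val_eqE /= => /negPf nl; rewrite acoord_delta // eqxx eq_sym nl !mul0r.
Qed.

(** Division by the node trades the derivative [(p * k) * z ^ (p * k - 1)] for
    [p * k * w ^ k / z], and the extra factor [p * k] shifts the exponents of [p]
    and [k] by one; for [p * k = 0] both sides vanish. *)
Lemma jac_node p x k (i : 'I_K) : zcoord x i != 0 ->
  jac p x k (cidx (ord_max : 'I_(ell i).+1)) = (zcoord x i)^-1 *
    \sum_(l < ell i) acoord x i l * p%:R ^+ l.+1 * (k%:R ^+ l.+1 * (zcoord x i ^+ p) ^+ k).
Proof.
move=> zi; rewrite jacE derive_fwd_coord (bigD1 i) //= [X in _ + X]big1 ?addr0; last first.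
  move=> j /negPf ji; rewrite zcoord_delta eq_sym ji /= !mulr0 addr0.
  by rewrite big1 ?mulr0 // => l _; rewrite acoord_delta // eq_sym ji !mul0r.
rewrite zcoord_delta !eqxx /= mulr1 big1; last first.
  by move=> l _; rewrite acoord_delta // eqxx gtn_eqF ?mul0r.
rewrite mulr0 add0r mulr_suml mulr_sumr; apply: eq_bigr => l _.
have -> : (p * k)%:R * zcoord x i ^+ (p * k).-1 = (p * k)%:R * zcoord x i ^+ (p * k) / zcoord x i.
  by case: (p * k)%N => [|q]; rewrite ?mul0r // exprSr mulrA mulfK.
by rewrite -exprM natrM !exprS; field.
Qed.

End Jacobian.

(** * Chords and angles on the unit circle *)

Section ChordAngle.
Context (R : realType).
Implicit Types (x y s t : R) (z w : R[i]).

Lemma cos_ge_half x : 0 <= x <= pi / 4 -> 1 / 2 <= cos x.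
Proof.
move=> /andP[x0 x4]; have p0 := pi_gt0 R.
have c0 : 0 <= cos x by apply: cos_ge0_pihalf; lra.
have : 0 <= cos (x *+ 2) by apply: cos_ge0_pihalf; lra.
by rewrite cos_mulr2n; nra.
Qed.

Lemma sin_ge_half_arg x : 0 <= x <= pi / 4 -> x / 2 <= sin x.
Proof.
move=> /andP[x0 x4]; have p0 := pi_gt0 R.
have [->|xn0] := eqVneq x 0; first by rewrite sin0 mul0r.
have xgt0 : 0 < x by rewrite lt_neqAle eq_sym xn0.
have sin_cont : {within `[0, x], continuous sin}%classic.
  by apply: continuous_subspaceT => y; apply: continuous_sin.
have [c] := MVT xgt0 (fun y _ => is_derive_sin y) sin_cont.
rewrite in_itv /= => /andP[c0 cx]; rewrite sin0 !subr0 => ->.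
have : 1 / 2 <= cos c by apply: cos_ge_half; lra.
nra.
Qed.

(** The right side is the square of the chord, [4 * sin (x / 2) ^ 2]; the sine is estimated by
    [sin (x / 2) = 2 * sin (x / 4) * cos (x / 4)], as [x / 4 <= pi / 4]. *)
Lemma chord_angle_sqr x : 0 <= x <= pi -> (x / 4) ^+ 2 <= 2 - 2 * cos x.
Proof.
move=> /andP[x0 xpi]; have p0 := pi_gt0 R.
set y := x / 4; have y4 : 0 <= y <= pi / 4 by rewrite /y; lra.
have hs := sin_ge_half_arg y4; have hc := cos_ge_half y4.
have /andP[y0 _] := y4.
have -> : 2 - 2 * cos x = 4 * sin (y *+ 2) ^+ 2.
  rewrite (_ : x = (y *+ 2) *+ 2); last by rewrite /y; lra.
  by rewrite cos_mulr2n cos2sin2; ring.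
have h : y / 2 <= sin (y *+ 2) by rewrite sin_mulr2n; nra.
nra.
Qed.

Lemma cmodE (a b : R) : cmod (Complex a b) = Num.sqrt (a ^+ 2 + b ^+ 2).
Proof. by []. Qed.

(** The argument is [acos a] or [- acos a] according to the sign of the
    imaginary part; at [-1] only the former is in the range of [carg]. *)
Lemma cargP z : cmod z = 1 ->
  - pi < carg z <= pi /\ z = Complex (cos (carg z)) (sin (carg z)).
Proof.
move=> z1.
suff /(xgetPex 0) : exists t, - pi < t <= pi /\
    z = Complex (cmod z * cos t) (cmod z * sin t).
  by rewrite -/(carg z) z1 !mul1r.
rewrite z1; case: z z1 => a b; rewrite cmodE => z1; have p0 := pi_gt0 R.
have ab1 : a ^+ 2 + b ^+ 2 = 1.
  rewrite -[LHS]sqr_sqrtr; last by rewrite addr_ge0 ?sqr_ge0.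
  by rewrite z1 expr1n.
have a1 : -1 <= a <= 1 by apply/andP; split; nra.
have cosa := acosK a1; have sina := sin_acos a1.
have a0 := acos_ge0 a1; have api := acos_lepi a1.
have sb : Num.sqrt (1 - a ^+ 2) = `|b|.
  by rewrite (_ : 1 - a ^+ 2 = b ^+ 2) ?sqrtr_sqr //; lra.
have [b0|b0] := leP 0 b.
  exists (acos a); rewrite !mul1r cosa sina sb ger0_norm //; split=> //.
  by rewrite api andbT; lra.
exists (- acos a); rewrite !mul1r cosN sinN cosa sina sb ltr0_norm // opprK; split=> //.
have : acos a < pi by apply: acos_ltpi; apply/andP; split; nra.
by move=> ?; apply/andP; split; lra.
Qed.

Lemma angdist_le_pi z w : angdist z w <= pi.
Proof.
rewrite /angdist ge_min; have [//|h] := leP (`|carg z - carg w|) pi.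
by apply/orP; right; lra.
Qed.

(** Both the chord and [angdist] depend on the difference of the arguments only
    modulo [2 pi] and up to sign. *)
Lemma angdist_le_chord z w : cmod z = 1 -> cmod w = 1 ->
  angdist z w / 4 <= cmod (z - w).
Proof.
move=> /cargP[zpi ze] /cargP[wpi we].
have ch : cmod (z - w) = Num.sqrt (2 - 2 * cos (carg z - carg w)).
  have -> : z - w = Complex (cos (carg z) - cos (carg w)) (sin (carg z) - sin (carg w)).
    by rewrite {1}ze {1}we.
  rewrite cmodE; congr Num.sqrt.
  have := cos2Dsin2 (carg z); have := cos2Dsin2 (carg w); rewrite cosB; nra.
rewrite ch.
have [d0 dpi] : 0 <= `|carg z - carg w| /\ `|carg z - carg w| < 2 * pi.
  by split=> //; rewrite ltr_norml; move: zpi wpi; lra.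
have -> : cos (carg z - carg w) = cos (angdist z w).
  have e1 : cos (carg z - carg w) = cos `|carg z - carg w|.
    by case: (ger0P (carg z - carg w)) => _; rewrite // cosN.
  rewrite e1 /angdist; case: (leP `|carg z - carg w| _) => // _.
  by rewrite mulr_natl cosB cos2pi sin2pi mul1r mul0r addr0.
have m0 : 0 <= angdist z w.
  by rewrite /angdist le_min d0 /=; lra.
rewrite -[leLHS]ger0_norm ?divr_ge0 // -sqrtr_sqr; apply: ler_wsqrtr.
by apply: chord_angle_sqr; rewrite m0 angdist_le_pi.
Qed.

End ChordAngle.

(** * Rows of the inverse Jacobian *)

Section InverseRows.
Context (C : numFieldType) (K : nat) (ell : 'I_K -> nat).
Local Notation N := (nvars ell).
Implicit Types (x : 'rV[C]_N) (P : {poly C}) (p : nat).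

Definition coef_row P : 'rV[C]_N := \row_k P`_k.

Definition nodes p x (i : 'I_K) : C := zcoord x i ^+ p.

Lemma coef_row_jac_coef P p x (i : 'I_K) (n : 'I_(ell i).+1) :
  (size P <= N)%N -> (n < ell i)%N ->
  (coef_row P *m jac p x) ord0 (cidx n) = p%:R ^+ n * emom n (nodes p x i) P.
Proof.
move=> sP ni; rewrite mxE (emom_widen _ _ sP) mulr_sumr; apply: eq_bigr => k _.
by rewrite mxE jac_coef // mulrCA !mulrA.
Qed.

Lemma coef_row_jac_node P p x (i : 'I_K) : (size P <= N)%N -> zcoord x i != 0 ->
  (coef_row P *m jac p x) ord0 (cidx (ord_max : 'I_(ell i).+1)) = (zcoord x i)^-1 *
    \sum_(l < ell i) acoord x i l * p%:R ^+ l.+1 * emom l.+1 (nodes p x i) P.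
Proof.
move=> sP zi; rewrite mxE.
under eq_bigr => k _.
  rewrite mxE jac_node // mulrCA mulr_sumr; over.
rewrite -mulr_sumr exchange_big; congr (_ * _); apply: eq_bigr => l _.
rewrite (emom_widen _ _ sP) mulr_sumr; apply: eq_bigr => k _.
by rewrite [LHS]mulrCA !mulrA.
Qed.

Lemma row_jac_delta p x (u : 'rV[C]_N) (j : 'I_K) (m : 'I_(ell j).+1) :
  (forall (i : 'I_K) (n : 'I_(ell i).+1), (n < ell i)%N ->
     (u *m jac p x) ord0 (cidx n) = ((i == j) && (n == m :> nat))%:R) ->
  (forall i : 'I_K, (u *m jac p x) ord0 (cidx (ord_max : 'I_(ell i).+1)) =
     ((i == j) && (ell i == m :> nat))%:R) ->
  u *m jac p x = delta_mx ord0 (cidx m).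
Proof.
move=> hlow htop; apply/rowP => b; have [i [n ->]] := cidx_surj b.
rewrite [RHS]mxE eqxx /=.
have -> : (cidx n == cidx m) = (i == j) && (n == m :> nat).
  apply/eqP/andP => [/cidx_inj[ij nm]|[/eqP ij /eqP nm]].
    by rewrite nm ij !eqxx.
  by subst i; congr cidx; apply: val_inj.
have [/hlow//|] := ltnP n (ell i) => ni.
have -> : n = ord_max by apply: val_inj; apply/eqP; rewrite /= eqn_leq ni andbT -ltnS.
exact: htop.
Qed.

Lemma sum_acoord_pred p x (j : 'I_K) m : (m <= ell j)%N ->
  \sum_(l < ell j) acoord x j l * p%:R ^+ l.+1 * (l.+1 == m)%:R =
  acoord_pred x j m * p%:R ^+ m.
Proof.
case: m => [|m] mj; first by rewrite big1 ?mul0r // => l _; rewrite mulr0.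
rewrite (bigD1 (Ordinal mj)) //= eqxx mulr1 big1 ?addr0 // => l.
by rewrite -val_eqE eqSS => /negPf ->; rewrite mulr0.
Qed.

(** The row of the inverse Jacobian for the amplitude [a_{l,j}], when [P] is the
    family of dual polynomials at the [j]-th node: the second term cancels the
    entry [a_{l-1,j} / z_j] of the first one in the column of [z_j]. *)
Definition coef_poly p x (j : 'I_K) (l : nat) (P : nat -> {poly C}) :=
  p%:R ^- l *: P l - (acoord_pred x j l / (acoord x j (ell j).-1 * p%:R ^+ ell j)) *: P (ell j).

(** The same for the node [z_j]: only the column of [z_j] in the Jacobian involves
    the moment of order [ell j] at the [j]-th node. *)
Definition node_poly p x (j : 'I_K) (P : nat -> {poly C}) :=
  (zcoord x j / (acoord x j (ell j).-1 * p%:R ^+ ell j)) *: P (ell j).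

Section Rows.
Context (p : nat) (x : 'rV[C]_N) (j : 'I_K) (P : nat -> {poly C}).
Hypotheses (p0 : (0 < p)%N) (ellj : (0 < ell j)%N) (z0 : forall i, zcoord x i != 0)
  (a0 : acoord x j (ell j).-1 != 0)
  (dualP : forall m, (m <= ell j)%N -> dual_poly ell (nodes p x) j m (P m)).

Let pX0 n : p%:R ^+ n != 0 :> C.
Proof. by rewrite expf_neq0 // pnatr_eq0 -lt0n. Qed.

Let top_acoord : acoord_pred x j (ell j) = acoord x j (ell j).-1.
Proof. by case: (ell j) ellj. Qed.

Lemma size_coef_poly l : (l <= ell j)%N -> (size (coef_poly p x j l P) <= N)%N.
Proof.
move=> lj; have [sl _] := dualP lj; have [st _] := dualP (leqnn (ell j)).
apply: leq_trans (size_polyD _ _) _; rewrite size_polyN geq_max.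
by rewrite !(leq_trans (size_scale_leq _ _)).
Qed.

Lemma coef_poly_dual (l : 'I_(ell j).+1) : (l < ell j)%N ->
  coef_row (coef_poly p x j l P) *m jac p x = delta_mx ord0 (cidx l).
Proof.
move=> lj; have sP := size_coef_poly (ltnW lj).
have [_ dl] := dualP (ltnW lj); have [_ dt] := dualP (leqnn (ell j)).
have mom i n : (n <= ell i)%N -> emom n (nodes p x i) (coef_poly p x j l P) =
    p%:R ^- l * ((i == j) && (n == l))%:R -
    acoord_pred x j l / (acoord x j (ell j).-1 * p%:R ^+ ell j) *
      ((i == j) && (n == ell j))%:R.
  by move=> ni; rewrite linearB !linearZ /= dl // dt.
apply: row_jac_delta => [i n ni|i].
  rewrite coef_row_jac_coef // mom; last exact: ltnW.
  have [ij|_] /= := eqVneq i j; last by rewrite !mulr0 subr0 mulr0.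
  subst i; rewrite (ltn_eqF ni) mulr0 subr0 mulrA.
  by have [->|_] := eqVneq (n : nat) l; rewrite ?mulr0 // mulr1 mulfV.
rewrite coef_row_jac_node //.
have [ij|ij] /= := eqVneq i j; last first.
  by rewrite big1 ?mulr0 // => k _; rewrite mom // (negPf ij) !mulr0 subr0 mulr0.
subst i; rewrite (gtn_eqF lj).
set t := acoord_pred x j l / _ in mom *.
have -> : \sum_(k < ell j) acoord x j k * p%:R ^+ k.+1 *
      emom k.+1 (nodes p x j) (coef_poly p x j l P) =
    p%:R ^- l * (\sum_(k < ell j) acoord x j k * p%:R ^+ k.+1 * (k.+1 == l)%:R) -
    t * (\sum_(k < ell j) acoord x j k * p%:R ^+ k.+1 * (k.+1 == ell j)%:R).
  rewrite !mulr_sumr -sumrB; apply: eq_bigr => k _.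
  by rewrite mom // eqxx /=; ring.
rewrite !sum_acoord_pred // ?(ltnW lj) // top_acoord mulrCA mulVf // mulr1.
by rewrite divfK ?mulf_neq0 // subrr mulr0.
Qed.

Lemma size_node_poly : (size (node_poly p x j P) <= N)%N.
Proof.
by have [st _] := dualP (leqnn (ell j)); rewrite (leq_trans (size_scale_leq _ _)).
Qed.

Lemma node_poly_dual : coef_row (node_poly p x j P) *m jac p x =
  delta_mx ord0 (cidx (ord_max : 'I_(ell j).+1)).
Proof.
have [_ dt] := dualP (leqnn (ell j)); have sP := size_node_poly.
apply: row_jac_delta => [i n ni|i].
  rewrite coef_row_jac_coef // linearZ /= dt 1?ltnW //.
  have [ij|_] /= := eqVneq i j; last by rewrite !mulr0.
  by subst i; rewrite (ltn_eqF ni) !mulr0.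
rewrite coef_row_jac_node //; have [ij|ij] /= := eqVneq i j; last first.
  by rewrite big1 ?mulr0 // => k _; rewrite linearZ /= dt // (negPf ij) !mulr0.
subst i; rewrite eqxx.
pose t := zcoord x j / (acoord x j (ell j).-1 * p%:R ^+ ell j).
have -> : \sum_(k < ell j) acoord x j k * p%:R ^+ k.+1 *
      emom k.+1 (nodes p x j) (node_poly p x j P) =
    t * (\sum_(k < ell j) acoord x j k * p%:R ^+ k.+1 * (k.+1 == ell j)%:R).
  rewrite !mulr_sumr; apply: eq_bigr => k _.
  by rewrite linearZ /= dt // eqxx /= -/t; ring.
by rewrite sum_acoord_pred // top_acoord /t divfK ?mulf_neq0 // mulVf.
Qed.

End Rows.

Lemma jac_unit p x :
  (forall a : 'I_N, exists u : 'rV[C]_N, u *m jac p x = delta_mx ord0 a) ->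
  jac p x \in unitmx.
Proof.
move=> /choice[u hu]; have [] := @mulmx1_unit _ _ (\matrix_a u a) (jac p x) => //.
by apply/row_matrixP => a; rewrite row_mul rowK hu row1.
Qed.

Lemma row_invmx_jac p x (u : 'rV[C]_N) (a : 'I_N) : jac p x \in unitmx ->
  u *m jac p x = delta_mx ord0 a -> row a (invmx (jac p x)) = u.
Proof. by move=> J1 hu; rewrite rowE -hu mulmxK. Qed.

End InverseRows.

(** * Moduli of complex numbers *)

Section ComplexModulus.
Context (R : realType).
Implicit Types (z w : R[i]) (P Q : {poly R[i]}).
Local Open Scope complex_scope.

Lemma normr_cmod z : `|z| = (cmod z)%:C.
Proof. by rewrite normc_def; case: z. Qed.

Lemma cmod_ge0 z : 0 <= cmod z.
Proof. by case: z => a b; apply: sqrtr_ge0. Qed.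

Lemma cmodM z w : cmod (z * w) = cmod z * cmod w.
Proof. exact: ComplexField.Normc.normcM. Qed.

Lemma cmodV z : cmod z^-1 = (cmod z)^-1.
Proof. exact: ComplexField.Normc.normcV. Qed.

Lemma cmodX z n : cmod (z ^+ n) = cmod z ^+ n.
Proof. by apply: complexI; rewrite rmorphXn -!normr_cmod normrX. Qed.

Lemma cmod_nat n : cmod (n%:R : R[i]) = n%:R.
Proof. by apply: complexI; rewrite rmorph_nat -!normr_cmod normr_nat. Qed.

Lemma cmod_sum (I : Type) (r : seq I) (D : pred I) (F : I -> R[i]) :
  cmod (\sum_(i <- r | D i) F i) <= \sum_(i <- r | D i) cmod (F i).
Proof.
rewrite -lecR -normr_cmod rmorph_sum; apply: le_trans (ler_norm_sum _ _ _) _.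
by apply: ler_sum => i _; rewrite normr_cmod.
Qed.

Lemma cmod_gt0 z : (0 < cmod z) = (z != 0).
Proof. by rewrite -ltcR -normr_cmod normr_gt0. Qed.

(** Real-valued, as the condition numbers are, whereas [l1norm] takes its values
    in the partially ordered complex field. *)
Definition cl1 P : R := \sum_(k < size P) cmod P`_k.

Lemma l1norm_cl1 P : l1norm P = (cl1 P)%:C.
Proof. by rewrite /cl1 rmorph_sum; apply: eq_bigr => k _; apply: normr_cmod. Qed.

Lemma cl1D P Q : cl1 (P + Q) <= cl1 P + cl1 Q.
Proof. by rewrite -lecR rmorphD /= -!l1norm_cl1; apply: l1normD. Qed.

Lemma cl1Z a P : cl1 (a *: P) = cmod a * cl1 P.
Proof. by apply: complexI; rewrite rmorphM /= -!l1norm_cl1 -normr_cmod; apply: l1normZ. Qed.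

Lemma cl1B P Q : cl1 (P - Q) <= cl1 P + cl1 Q.
Proof.
apply: le_trans (cl1D _ _) _; rewrite -scaleN1r cl1Z.
rewrite (_ : cmod (-1) = 1) ?mul1r //.
by apply: complexI; rewrite -normr_cmod normrN1.
Qed.

Lemma cl1_widen N P : (size P <= N)%N -> cl1 P = \sum_(k < N) cmod P`_k.
Proof.
move=> sP; apply: complexI; rewrite -l1norm_cl1 (l1norm_widen sP) rmorph_sum.
by apply: eq_bigr => k _; apply: normr_cmod.
Qed.

End ComplexModulus.

(** * Condition numbers *)

Section ConditionNumbers.
Context (R : realType) (K : nat) (ell : 'I_K -> nat).
Local Notation N := (nvars ell).
Local Notation M := (\max_(i < K) ell i)%N.
Implicit Types (x : 'rV[R[i]]_N) (p : nat) (A : R).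

(** The amplitudes being multiplied by [p ^ l] with [l] at most
    [\max_i ell i - 1], this is the growth of the measurements with [p]. *)
Lemma cmod_fwd_le A x p (k : 'I_N) : 0 <= A ->
  (forall i, cmod (zcoord x i) = 1) ->
  (forall i l, (l < ell i)%N -> cmod (acoord x i l) <= A) -> (0 < p)%N ->
  cmod (fwd p x ord0 k) <= (\sum_(i < K) \sum_(l < ell i) A * N%:R ^+ l) * p%:R ^+ M.-1.
Proof.
move=> A0 z1 aA p0; rewrite mxE mulr_suml; apply: le_trans (cmod_sum _ _ _) _.
apply: ler_sum => i _; rewrite cmodM cmodX z1 expr1n mul1r mulr_suml.
apply: le_trans (cmod_sum _ _ _) _; apply: ler_sum => l _.
rewrite !cmodM !cmodX !cmod_nat mulrAC; apply: ler_pM; rewrite ?mulr_ge0 ?cmod_ge0 ?exprn_ge0 //.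
  apply: ler_pM; rewrite ?cmod_ge0 ?exprn_ge0 ?aA //.
  by apply: lerXn2r; rewrite ?nnegrE ?ler0n // ler_nat ltnW.
apply: ler_weXn2l; first by rewrite ler1n.
have : (l < M)%N by apply: leq_trans (ltn_ord l) _; apply: (@leq_bigmax _ _ i).
by case: M.
Qed.

Lemma kappa_le p x (a : 'I_N) (Q : {poly R[i]}) (D : R) : jac p x \in unitmx ->
  (size Q <= N)%N -> coef_row ell Q *m jac p x = delta_mx ord0 a ->
  (forall k, cmod (fwd p x ord0 k) <= D) -> kappa p x a <= cl1 Q * D.
Proof.
move=> J1 sQ hQ hD; rewrite (cl1_widen sQ) mulr_suml; apply: ler_sum => k _.
have -> : invmx (jac p x) a k = Q`_k.
  by have /rowP/(_ k) := row_invmx_jac J1 hQ; rewrite !mxE.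
by apply: ler_wpM2l; rewrite ?cmod_ge0.
Qed.

Lemma eta_j_le_pi p x j : eta_j p x j <= pi.
Proof. exact: bigmin_le_id. Qed.

Lemma eta_j_le_angdist p x (i j : 'I_K) : i != j ->
  eta_j p x j <= angdist (zcoord x i ^+ p) (zcoord x j ^+ p).
Proof. by move=> ij; apply: bigmin_le_cond. Qed.

Lemma eta_min_le p x j : eta_min p x <= eta_j p x j.
Proof. exact: bigmin_le. Qed.

(** The chord between two nodes dominates a quarter of their angle, which is at
    least [eta_j].  With no other node the separation holds vacuously, and [4 / eta_j] is then
    [4 / pi >= 1]. *)
Lemma separated_nodes p x j : (forall i, cmod (zcoord x i) = 1) -> 0 < eta_j p x j ->
  separated (nodes p x) (4 / eta_j p x j)%:C%C j.
Proof.
move=> z1 eta0.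
have w1 i : cmod (nodes p x i) = 1 by rewrite cmodX z1 expr1n.
split=> [i||i ij]; first by rewrite normr_cmod w1.
  rewrite -[1]/((1 : R)%:C)%C lecR ler_pdivlMr // mul1r.
  by apply: le_trans (eta_j_le_pi _ _ _) _; have := pihalf_lt2 R; lra.
have hd : eta_j p x j / 4 <= cmod (nodes p x j - nodes p x i).
  have -> : cmod (nodes p x j - nodes p x i) = cmod (nodes p x i - nodes p x j).
    by apply: complexI; rewrite -!normr_cmod distrC.
  apply: le_trans (angdist_le_chord (w1 i) (w1 j)).
  by rewrite ler_pM2r ?invr_gt0 //; apply: eta_j_le_angdist.
have hd0 : 0 < cmod (nodes p x j - nodes p x i).
  by apply: lt_le_trans hd; rewrite divr_gt0.
split; first by rewrite cmod_gt0 subr_eq0 in hd0.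
rewrite normr_cmod lecR cmodV -[leRHS]invrK lef_pV2 ?posrE ?invr_gt0 ?divr_gt0 //.
by rewrite invf_div.
Qed.

(** The target exponent of [p] splits into [p ^ -l] from the inverse Jacobian
    and [p ^ (m - 1)] from the measurements. *)
Lemma inv_exprz p l m : (0 < p)%N -> (0 < m)%N ->
  1 / p%:R ^ ((l%:Z + 1) - m%:Z) = p%:R ^- l * p%:R ^+ m.-1 :> R.
Proof.
move=> p0; case: m => // m _; have pn0 : p%:R != 0 :> R by rewrite pnatr_eq0 -lt0n.
have -> : (l%:Z + 1) - m.+1%:Z = l%:Z - m%:Z by lia.
by rewrite expfzDr // -exprnP -exprnN div1r invfM invrK.
Qed.

Lemma dual_family_exists : exists B : nat, forall x p j,
  (forall i, cmod (zcoord x i) = 1) -> 0 < eta_j p x j ->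
  exists P : nat -> {poly R[i]}, forall m, (m <= ell j)%N ->
    dual_poly ell (nodes p x) j m (P m) /\
    cl1 (P m) <= B%:R * (4 / eta_j p x j) ^+ (N.-1 - m).
Proof.
have [B hB] := dual_poly_exists R[i] ell N; exists B => x p j z1 eta0.
have sep := separated_nodes z1 eta0.
suff /choice[P hP] : forall m, exists P : {poly R[i]}, (m <= ell j)%N ->
    dual_poly ell (nodes p x) j m P /\
    cl1 P <= B%:R * (4 / eta_j p x j) ^+ (N.-1 - m) by exists P.
move=> m; have [mj|jm] := leqP m (ell j); last by exists 0.
have mN : (ell j - m < N)%N by have := cofactor_degreeE ell j; lia.
have [P dP lP] := hB _ _ _ _ sep mj mN; exists P => _; split=> //.
by rewrite -lecR -l1norm_cl1 rmorphM rmorphXn rmorph_nat.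
Qed.

Section Bounds.
Context (x : 'rV[R[i]]_N) (p : nat) (j : 'I_K) (B : nat) (P : nat -> {poly R[i]}).
Hypotheses (z1 : forall i, cmod (zcoord x i) = 1) (p0 : (0 < p)%N)
  (eta0 : 0 < eta_j p x j)
  (cl1P : forall m, (m <= ell j)%N -> cl1 (P m) <= B%:R * (4 / eta_j p x j) ^+ (N.-1 - m)).

(** The exponent may be raised from [N.-1 - m] to [N - l] as [4 / eta_j >= 1]. *)
Lemma cl1_dual_le l m : (l <= m)%N -> (m <= ell j)%N ->
  cl1 (P m) <= B%:R * 4 ^+ N * (1 / eta_j p x j) ^+ (N - l).
Proof.
move=> lm mj; apply: le_trans (cl1P mj) _; rewrite -mulrA; apply: ler_wpM2l => //.
have e1 : 1 <= 4 / eta_j p x j.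
  rewrite ler_pdivlMr // mul1r; apply: le_trans (eta_j_le_pi _ _ _) _.
  by have := pihalf_lt2 R; lra.
apply: (@le_trans _ _ ((4 / eta_j p x j) ^+ (N - l))).
  by apply: ler_weXn2l => //; lia.
rewrite div1r exprMn; apply: ler_wpM2r.
  by rewrite exprn_ge0 // invr_ge0 ltW.
by apply: ler_weXn2l; [rewrite ler1n | lia].
Qed.

Lemma cl1_coef_poly_le l : (l < ell j)%N ->
  cl1 (coef_poly p x j l P) <= B%:R * 4 ^+ N * (1 / eta_j p x j) ^+ (N - l) *
    (1 + cmod (acoord_pred x j l) / (cmod (acoord x j (ell j).-1) * p%:R ^+ (ell j - l))) *
    p%:R ^- l.
Proof.
move=> lj; have pX n : 0 < p%:R ^+ n :> R by rewrite exprn_gt0 // ltr0n.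
apply: le_trans (cl1B _ _) _; rewrite !cl1Z !cmodM !cmodV !cmodM !cmodX !cmod_nat.
set b := _ * _ ^+ (N - l); rewrite -[leRHS]mulrA mulrDl mul1r mulrDr.
apply: lerD.
  by rewrite mulrC; apply: ler_wpM2r; [rewrite invr_ge0 ltW|apply: cl1_dual_le => //; apply: ltnW].
have -> : p%:R ^+ ell j = p%:R ^+ (ell j - l) * p%:R ^+ l :> R.
  by rewrite -exprD subnK // ltnW.
rewrite (mulrA (cmod (acoord x j _))) invfM mulrC -(mulrA (cmod (acoord_pred x j l))).
apply: ler_wpM2r; last by apply: cl1_dual_le => //; apply: ltnW.
by rewrite !mulr_ge0 ?invr_ge0 ?mulr_ge0 ?cmod_ge0 ?(ltW (pX _)).
Qed.

Lemma cl1_node_poly_le :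
  cl1 (node_poly p x j P) <= B%:R * 4 ^+ N * (1 / eta_j p x j) ^+ (N - ell j) *
    (1 / cmod (acoord x j (ell j).-1)) * p%:R ^- ell j.
Proof.
have pX n : 0 < p%:R ^+ n :> R by rewrite exprn_gt0 // ltr0n.
set b := _ * _ ^+ (N - ell j).
rewrite cl1Z !cmodM !cmodV !cmodM !cmodX !cmod_nat z1 invfM div1r mul1r mulrC -(mulrA b).
apply: ler_wpM2r; last exact: cl1_dual_le.
by rewrite mulr_ge0 ?invr_ge0 ?cmod_ge0 ?(ltW (pX _)).
Qed.

End Bounds.

End ConditionNumbers.

Theorem theorem3p1 (R : realType) (K : nat) (hK : (1 <= K)%N)
    (ell : 'I_K -> nat) (hell : forall j : 'I_K, (0 < ell j)%N)
    (A : R) (hA : 0 < A) :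
  exists C5 C6 : R,
  forall (x : 'rV[R[i]]_(nvars ell)) (p : nat),
    (forall j : 'I_K, cmod (zcoord x j) = 1) ->
    (forall (j : 'I_K) (l : nat), (l < ell j)%N -> cmod (acoord x j l) <= A) ->
    (1 <= p)%N ->
    0 < eta_min p x ->
    (forall j : 'I_K, acoord x j (ell j).-1 != 0) ->
    jac p x \in unitmx /\
    forall j : 'I_K,
      (forall l : nat, (l < ell j)%N ->
        kappa p x (cidx (inord l : 'I_(ell j).+1)) <=
          C5 * (1 / eta_j p x j) ^+ (nvars ell - l)
             * (1 + cmod (acoord_pred x j l) /
                    (cmod (acoord x j (ell j).-1) * p%:R ^+ (ell j - l)))
             * (1 / p%:R ^ ((l%:Z + 1) - (\max_(i < K) ell i)%:Z))) /\
      kappa p x (cidx (ord_max : 'I_(ell j).+1)) <=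
          C6 * (1 / eta_j p x j) ^+ (nvars ell - ell j)
             * (1 / cmod (acoord x j (ell j).-1))
             * (1 / p%:R ^ (((ell j)%:Z + 1) - (\max_(i < K) ell i)%:Z)).
Proof.
have [B dualB] := dual_family_exists R ell.
pose D : R := \sum_(i < K) \sum_(l < ell i) A * (nvars ell)%:R ^+ l.
exists (B%:R * 4 ^+ nvars ell * D), (B%:R * 4 ^+ nvars ell * D).
move=> x p z1 aA p1 eta0 a0.
have etaj0 j : 0 < eta_j p x j by apply: lt_le_trans (eta_min_le p x j).
have z0 i : zcoord x i != 0 by rewrite -cmod_gt0 z1 ltr01.
have fwdD k := cmod_fwd_le k (ltW hA) z1 aA p1.
have M0 : (0 < \max_(i < K) ell i)%N.
  by apply: leq_trans (hell (Ordinal hK)) _; apply: (@leq_bigmax _ _ (Ordinal hK)).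
have J1 : jac p x \in unitmx.
  apply: jac_unit => a; have [j [m ->]] := cidx_surj a.
  have [P hP] := dualB x p j z1 (etaj0 j).
  have dP m' (m'j : (m' <= ell j)%N) := (hP m' m'j).1.
  have [mj|mj] := ltnP m (ell j); first by eexists; apply: (coef_poly_dual p1 (hell j) z0 (a0 j) dP).
  have -> : m = ord_max by apply: val_inj; apply/eqP; rewrite /= eqn_leq mj andbT -ltnS.
  by eexists; apply: (node_poly_dual p1 (hell j) z0 (a0 j) dP).
split=> // j; have [P hP] := dualB x p j z1 (etaj0 j).
have dP m (mj : (m <= ell j)%N) := (hP m mj).1.
have lP m (mj : (m <= ell j)%N) := (hP m mj).2.
have pM0 : 0 <= p%:R ^+ (\max_(i < K) ell i).-1 :> R by apply: exprn_ge0.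
have D0 : 0 <= D.
  by do 2!(apply: sumr_ge0 => ? _); rewrite mulr_ge0 ?exprn_ge0 // ltW.
split=> [l lj|].
  have lE : (inord l : 'I_(ell j).+1) = l :> nat by rewrite inordK // leqW.
  have := @coef_poly_dual _ _ _ p x j P p1 (hell j) z0 (a0 j) dP (inord l : 'I_(ell j).+1).
  rewrite lE => /(_ lj) hu.
  apply: le_trans (kappa_le J1 (size_coef_poly dP (ltnW lj)) hu fwdD) _.
  rewrite inv_exprz // mulrA [leRHS]mulrA; apply: ler_wpM2r => //.
  apply: le_trans (ler_wpM2r D0 (cl1_coef_poly_le p1 (etaj0 j) lP lj)) _.
  by rewrite le_eqVlt; apply/orP; left; apply/eqP; rewrite /D; ring.
apply: le_trans (kappa_le J1 (size_node_poly dP) (node_poly_dual p1 (hell j) z0 (a0 j) dP) fwdD) _.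
rewrite inv_exprz // mulrA [leRHS]mulrA; apply: ler_wpM2r => //.
apply: le_trans (ler_wpM2r D0 (cl1_node_poly_le z1 p1 (etaj0 j) lP)) _.
by rewrite le_eqVlt; apply/orP; left; apply/eqP; rewrite /D; ring.
Qed.
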